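(* Let $f,g\in\mathcal T$. Then for every real $y>0$, $$\operatorname{Re}\frac{(f*g)(iy)}{f(iy)}\ \ge\ 1 .$$
   Context: Let $\Lambda:=\mathbb C\setminus[1,\infty)$. $\mathcal T$ denotes the set of all functions $f:\Lambda\to\mathbb C$ of the form $$f(z)=\int_0^1\frac{d\mu(t)}{1-tz},\qquad z\in\Lambda,$$ where $\mu$ is a Borel probability measure on $[0,1]$. For $f,g\in\mathcal T$ with Taylor expansions $f(z)=\sum_{k\ge0}a_kz^k$ and $g(z)=\sum_{k\ge0}b_kz^k$ in the unit disk, the Hadamard product is $(f*g)(z):=\sum_{k\ge0}a_kb_kz^k$ for $|z|<1$. It is known that $f*g$ again belongs to $\mathcal T$, that is, it extends analytically to $\Lambda$ as an element of $\mathcal T$; $(f*g)(iy)$ denotes the value of this extension. *)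

(* Defs.v *)
From mathcomp Require Export all_boot all_order all_algebra complex.
From mathcomp Require Export all_classical all_reals all_analysis.
Export numFieldNormedType.Exports.

Set Implicit Arguments.
Unset Strict Implicit.
Unset Printing Implicit Defensive.

Import Order.TTheory GRing.Theory Num.Theory.

Local Open Scope classical_set_scope.
Local Open Scope ring_scope.
Local Open Scope complex_scope.

Definition cut_plane (R : realType) : set R[i] :=
  ~` [set x%:C | x in `[1, +oo[%classic].

Definition cintegral (R : realType) (mu : probability (measurableTypeR R) R)
    (D : set R) (F : R -> R[i]) : R[i] :=
  (\int[mu]_(t in D) complex.Re (F t)) +i* (\int[mu]_(t in D) complex.Im (F t)).

(* Borel probability measures on [0, 1] are encoded as Borel probability
   measures on the line that give mass 1 to [0, 1].  Functions on the cut
   plane are encoded as total functions whose values on the cut [1, +oo[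
   are left unconstrained. *)
Definition classT (R : realType) (f : R[i] -> R[i]) : Prop :=
  exists2 mu : probability (measurableTypeR R) R,
    mu `[0, 1]%classic = 1%E &
    forall z, cut_plane z ->
      f z = cintegral mu `[0, 1]%classic (fun t => (1 - t%:C * z)^-1).

(* The alias R[i]^o carries the topology given by the complex modulus. *)
Definition has_taylor (R : realType) (f : R[i] -> R[i]) (a : nat -> R[i]) : Prop :=
  forall z : R[i], `|z| < 1 ->
    series (fun k => a k * z ^+ k : R[i]^o) @ \oo --> (f z : R[i]^o).

Definition is_hadamard (R : realType) (f g h : R[i] -> R[i]) : Prop :=
  classT h /\
  exists a b : nat -> R[i],
    [/\ has_taylor f a, has_taylor g b & has_taylor h (fun k => a k * b k)].

(* For f and g of class T such an extension exists and is unique on the cut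
   plane; the default value 0 is used when there is none. *)
Definition hadamard (R : realType) (f g : R[i] -> R[i]) : R[i] -> R[i] :=
  xget (fun=> 0) [set h | is_hadamard f g h].

(* Main.v *)
(* For [f] the transform of [mu] and [g] that of [nu], [f * g] is the transform of the
   multiplicative convolution of [mu] and [nu], since moments multiply; it is determined
   by its Taylor coefficients because [1 / (1 - i y t)] is a uniform limit of polynomials
   on [0, 1].  Hence [(f * g)(i y)] is the [nu]-average of [f(s i y)], and it is enough
   that [Re (f(s i y) / f(i y)) >= 1] for [s] in [0, 1].  Multiplied by [|f(i y)|^2], this
   compares two double integrals against [mu x mu], and the difference of the integrands
   becomes nonnegative once it is symmetrized in the two variables. *)
From HB Require Import structures.
Require Import Defs.
From mathcomp Require Import ring lra measurable_realfun.
Import Order.TTheory GRing.Theory Num.Theory.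
Local Open Scope classical_set_scope.
Local Open Scope ring_scope.
Local Open Scope complex_scope.

(** * Uniqueness of power series coefficients *)

Section PowerSeries.
Set Implicit Arguments.
Unset Strict Implicit.
Variable K : numFieldType.
Implicit Types (d : nat -> K).

Lemma sum_geometric_le2 (w : K) n : 0 <= w -> w <= 2^-1 -> \sum_(i < n) w ^+ i <= 2.
Proof.
move=> w0 w2; have h : 2^-1 <= 1 - w.
  by rewrite lerBrDr -lerBrDl (le_trans w2) // {2}[1]splitr mul1r addrK.
have : (1 - w) * \sum_(i < n) w ^+ i <= 1.
  by rewrite -opprB mulNr -subrX1 opprB lerBlDr lerDl exprn_ge0.
move=> H; have S0 : 0 <= \sum_(i < n) w ^+ i by rewrite sumr_ge0 // => i _; rewrite exprn_ge0.
have := le_trans (ler_wpM2r S0 h) H; rewrite mulrC ler_pdivrMr ?ltr0n // mul1r; exact.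
Qed.

(** Convergence at [1/2] gives a geometric bound on the coefficients, so for small [x] the terms
    after the constant one are too small to cancel it. Only partial sums are estimated, over any
    [numFieldType], where [0 < x] makes [x] real; this covers [R[i]]. *)
Lemma pseries_eq0_head d :
  (forall x : K, 0 < x -> x < 1 -> series (fun k => d k * x ^+ k : K^o) @ \oo --> (0 : K^o)) ->
  d 0%N = 0.
Proof.
move=> Hd; have h0 : (0 : K) < 2^-1 by rewrite invr_gt0.
have h1 : (2^-1 : K) < 1 by rewrite invf_lt1 ?ltr1n.
have [C C0 HC] : exists2 C, 0 <= C & forall k, `|d k| <= C * 2 ^+ k.
  have /cvgP/cvg_series_cvg_0/cvgrPdist_le/(_ _ (@ltr01 K)) [N _ HN] := Hd _ h0 h1.
  (* From rank [N] on, the terms at [1/2] have modulus at most 1; the finite sum takes care of the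
     earlier ones. *)
  exists (1 + \sum_(k < N) `|d k * 2^-1 ^+ k|) => [|k]; first by rewrite addr_ge0 ?sumr_ge0.
  have -> : `|d k| = `|d k * 2^-1 ^+ k| * 2 ^+ k.
    by rewrite normrM normrX (ger0_norm (ltW h0)) exprVn divfK // expf_neq0.
  rewrite ler_wpM2r ?exprn_ge0 //; case: (ltnP k N) => kN.
    by rewrite (bigD1 (Ordinal kN)) //= addrCA lerDl addr_ge0 ?sumr_ge0.
  by apply: ler_wpDr; [rewrite sumr_ge0|have := HN _ kN; rewrite sub0r normrN].
apply/eqP/negPn/negP => d0; pose e := `|d 0%N|.
have e0 : 0 < e by rewrite normr_gt0.
(* With [x = e / (8C + 4e)] both [x <= 1/4] and [4Cx <= e/2] hold. The tail is then at most
   [4Cx <= e/2] and a late partial sum at most [e/4], so that [e <= 3e/4], which is absurd. *)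
pose D := C *+ 8 + e *+ 4.
have D0 : 0 < D by rewrite ltr_wpDl ?mulrn_wge0 ?pmulrn_lgt0.
pose x := e / D.
have x0 : 0 < x by rewrite divr_gt0.
have x4 : x <= 4^-1.
  rewrite ler_pdivrMr // mulrC ler_pdivlMr ?ltr0n // mulr_natr lerDr mulrn_wge0 //.
have x2 : x * 2 <= 2^-1.
  by rewrite -ler_pdivlMr ?ltr0n // -invfM -natrM.
have xlt1 : x < 1 by rewrite (le_lt_trans x4) // invf_lt1 ?ltr1n ?ltr0n.
have Cx : C * x *+ 4 <= e / 2.
  have -> : C * x *+ 4 = e * (C *+ 4 / D) by rewrite /x; move: (D^-1) => i; ring.
  rewrite ler_wpM2l ?(ltW e0) // ler_pdivrMr // mulrC ler_pdivlMr ?ltr0n //.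
  by rewrite mulr_natr -mulrnA lerDl mulrn_wge0 // ltW.
have /cvgrPdist_le/(_ _ (divr_gt0 e0 (ltr0n _ 4))) [N _ /(_ N.+1 (leqnSn N))] := Hd _ x0 xlt1.
rewrite sub0r normrN /series /= big_mkord big_ord_recl expr0 mulr1 => HN.
have tail : `|\sum_(i < N) d (bump 0 i) * x ^+ bump 0 i| <= C * x *+ 4.
  apply: le_trans (ler_norm_sum _ _ _) _.
  apply: (@le_trans _ _ (\sum_(i < N) C * x * 2 * (x * 2) ^+ i)).
    apply: ler_sum => i _; rewrite /bump add1n normrM normrX (gtr0_norm x0).
    apply: le_trans (ler_wpM2r (exprn_ge0 _ (ltW x0)) (HC _)) _.
    rewrite [X in X <= _](_ : _ = C * x * 2 * (x * 2) ^+ i) //.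
    by rewrite -[LHS]mulrA -exprMn [2 * x]mulrC exprS !mulrA.
  have -> : C * x *+ 4 = C * x * 2 * 2 by ring.
  rewrite -mulr_sumr.
  apply: ler_wpM2l; first by apply: mulr_ge0; [apply: mulr_ge0; [exact: C0|exact: ltW]|exact: ler0n].
  by apply: sum_geometric_le2 => //; apply: mulr_ge0; [exact: ltW|exact: ler0n].
have : e <= e / 4 + e / 2.
  rewrite {1}/e -[d 0%N](addrK (\sum_(i < N) d (bump 0 i) * x ^+ bump 0 i)).
  by apply: le_trans (ler_normB _ _) _; apply: lerD => //; exact: le_trans Cx.
have -> : e / 4 + e / 2 = e * (3 / 4) by field.
by rewrite ler_pMr // ler_pdivlMr ?ltr0n // mul1r ler_nat.
Qed.

(** Once the constant term vanishes, division by [x] gives a series of the same kind with shifted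
    coefficients; hence the induction on [k] for all [d] at once. *)
Lemma pseries_eq0 d :
  (forall x : K, 0 < x -> x < 1 -> series (fun k => d k * x ^+ k : K^o) @ \oo --> (0 : K^o)) ->
  forall k, d k = 0.
Proof.
move=> Hd k; elim: k d Hd => [|k IHk] d Hd; first exact: pseries_eq0_head.
have d0 := pseries_eq0_head Hd.
apply: (IHk (fun k => d k.+1)) => x x0 x1.
have -> : series (fun k => d k.+1 * x ^+ k : K^o) =
    (fun n => x^-1 * series (fun k => d k * x ^+ k : K^o) n.+1).
  apply/funext => n; rewrite /series /= !big_mkord big_ord_recl d0 mul0r add0r mulr_sumr.
  by apply: eq_bigr => i _; rewrite lift0 exprS mulrCA mulKf ?gt_eqF.
rewrite -[X in _ --> X](mulr0 x^-1); apply: cvgMr.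
by have := Hd x x0 x1; rewrite -cvg_shiftS.
Qed.
End PowerSeries.

(** * Continuous functions on [0, 1] and their integrals *)

Section UnitInterval.
Set Implicit Arguments.
Unset Strict Implicit.
Variable R : realType.
Implicit Types (mu nu : probability (measurableTypeR R) R) (F G : R -> R).

(** Continuity is that of [F] on the line at each point of [0, 1], two-sided at the endpoints:
    stronger than continuity of the restriction, and directly stable under the limit rules. *)
Definition continuous_on01 F := forall t : R, 0 <= t <= 1 -> {for t, continuous F}.

Local Notation I01 := (`[0, 1]%classic : set R).

Lemma continuous_on01_cst (c : R) : continuous_on01 (fun=> c).
Proof. by move=> t _; exact: cst_continuous. Qed.

Lemma continuous_on01_id : continuous_on01 (fun t : R => t).
Proof. by move=> t _; exact: cvg_id. Qed.

Lemma continuous_on01D F G : continuous_on01 F -> continuous_on01 G ->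
  continuous_on01 (fun t => F t + G t).
Proof. by move=> cF cG t t01; apply: cvgD; [exact: cF|exact: cG]. Qed.

Lemma continuous_on01B F G : continuous_on01 F -> continuous_on01 G ->
  continuous_on01 (fun t => F t - G t).
Proof. by move=> cF cG t t01; apply: cvgB; [exact: cF|exact: cG]. Qed.

Lemma continuous_on01M F G : continuous_on01 F -> continuous_on01 G ->
  continuous_on01 (fun t => F t * G t).
Proof. by move=> cF cG t t01; apply: cvgM; [exact: cF|exact: cG]. Qed.

Lemma continuous_on01V F : continuous_on01 F -> (forall t : R, 0 <= t <= 1 -> F t != 0) ->
  continuous_on01 (fun t => (F t)^-1).
Proof. by move=> cF F0 t t01; apply: cvgV; [exact: F0|exact: cF]. Qed.

Lemma continuous_on01_horner (P : {poly R}) : continuous_on01 (horner P).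
Proof. by move=> t _; exact: continuous_horner. Qed.

Lemma continuous_on01X n : continuous_on01 (fun t : R => t ^+ n).
Proof. by move=> t _; exact: exprn_continuous. Qed.

Lemma continuous_on01_dilation F (s : R) : 0 <= s <= 1 -> continuous_on01 F ->
  continuous_on01 (fun t => F (s * t)).
Proof.
move=> /andP[s0 s1] cF t /andP[t0 t1].
apply: (@continuous_comp _ _ _ (fun t => s * t) F); first exact: mulrl_continuous.
by apply: cF; rewrite mulr_ge0 //= mulr_ile1.
Qed.

Lemma continuous_on01_within F : continuous_on01 F -> {within I01, continuous F}.
Proof.
by move=> cF; apply: continuous_in_subspaceT => t; rewrite inE /= in_itv; exact: cF.
Qed.

Lemma continuous_on01_measurable F : continuous_on01 F ->
  measurable_fun I01 (F : measurableTypeR R -> measurableTypeR R).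
Proof.
by move=> /continuous_on01_within; apply: subspace_continuous_measurable_fun.
Qed.

Lemma continuous_on01_bounded F : continuous_on01 F ->
  exists2 M, 0 <= M & forall t : R, 0 <= t <= 1 -> `|F t| <= M.
Proof.
move=> /continuous_on01_within cF.
have /compact_bounded [M [_ HM]] := continuous_compact cF (@segment_compact R 0 1).
exists (`|M| + 1) => [|t t01]; first by rewrite addr_ge0.
by apply: HM; [rewrite ltr_pwDr ?ler_norm|exists t => //=; rewrite in_itv].
Qed.

Lemma continuous_on01_integrable mu F : continuous_on01 F ->
  mu.-integrable I01 (EFin \o F).
Proof.
move=> cF; apply: measurable_bounded_integrable => //.
- by apply: le_lt_trans (ltry 1); exact: probability_le1.
- exact: continuous_on01_measurable.
- have [M _ HM] := continuous_on01_bounded cF.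
  exists M; split; first exact: num_real.
  by move=> x Mx t /=; rewrite in_itv /= => /HM /le_trans; apply; exact: ltW.
Qed.

Lemma integral01_unit_ball mu F : mu I01 = 1%E -> continuous_on01 F ->
  forall c : R, (forall t : R, 0 <= t <= 1 -> `|F t| <= c) ->
  `|\int[mu]_(t in I01) F t| <= c.
Proof.
move=> mu1 cF c Hc; have iF := continuous_on01_integrable mu cF.
apply: le_trans (le_normr_Rintegral _ iF) _ => //.
have -> : c = \int[mu]_(t in I01) cst c t by rewrite Rintegral_cst //= mu1 mulr1.
apply: (le_Rintegral _ (integrable_norm iF)) => //.
apply: continuous_on01_integrable; exact: continuous_on01_cst.
Qed.

Lemma integral01_ge mu F c : mu I01 = 1%E -> mu.-integrable I01 (EFin \o F) ->
  (forall t : R, 0 <= t <= 1 -> c <= F t) -> c <= \int[mu]_(t in I01) F t.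
Proof.
move=> mu1 iF Hc; have -> : c = \int[mu]_(t in I01) cst c t.
  by rewrite Rintegral_cst //= mu1 mulr1.
apply: le_Rintegral => //.
apply: continuous_on01_integrable; exact: continuous_on01_cst.
Qed.

(** The complement of [0, 1] is negligible. This links integrals on [0, 1] to integrals on the whole
    line, where change of variables and Fubini are applied. *)
Lemma integral01_restrict mu (F : R -> R) : mu I01 = 1%E ->
  mu.-integrable setT (EFin \o F) ->
  (\int[mu]_t (F t)%:E = \int[mu]_(t in I01) (F t)%:E)%E.
Proof.
move=> mu1 iF.
have mI : measurable (I01 : set (measurableTypeR R)) by [].
rewrite (@negligible_integral _ _ _ mu setT (~` I01)) //.
- by rewrite setDE setCK setTI.
- exact: measurableC.
- by apply: etrans (probability_setC mu mI) _; rewrite mu1 subee.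
Qed.

(** * Multiplicative convolution of measures *)

Definition mul_pair (p : measurableTypeR R * measurableTypeR R) : measurableTypeR R :=
  p.1 * p.2.

Lemma measurable_mul_pair : measurable_fun setT mul_pair.
Proof. by apply: measurable_funM. Qed.

HB.instance Definition _ := isMeasurableFun.Build _ _ _ _ mul_pair measurable_mul_pair.

Definition mul_convolution nu mu : probability (measurableTypeR R) R :=
  distribution (nu \x mu)%E mul_pair.

(** The unit square has full product mass, and multiplication maps it into [0, 1]. *)
Lemma mul_convolution_unit nu mu : nu I01 = 1%E -> mu I01 = 1%E ->
  mul_convolution nu mu I01 = 1%E.
Proof.
move=> nu1 mu1; apply/eqP; rewrite eq_le probability_le1 //=.
rewrite -[X in (X <= _)%E](_ : (nu \x mu)%E (I01 `*` I01) = 1%E); last first.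
  by rewrite product_measure1E // -[RHS]mule1; congr (_ * _)%E; [exact: nu1|exact: mu1].
apply: le_measure; rewrite ?inE.
- exact: measurableX.
- by rewrite -[X in measurable X]setTI; exact: measurable_mul_pair.
- move=> [s t] /=; rewrite !in_itv /= => -[/andP[s0 s1] /andP[t0 t1]].
  by rewrite /mul_pair /= mulr_ge0 //= mulr_ile1.
Qed.

(** Change of variables, then Fubini, for the extension [G] of [F] by zero, which is bounded and
    measurable on the line. Integrability of the inner integral in [s] is part of the conclusion so
    that [integral01_ge] can be applied to the outer one. *)
Lemma integral_mul_convolution nu mu F : nu I01 = 1%E -> mu I01 = 1%E ->
  continuous_on01 F ->
  nu.-integrable I01 (fun s => (\int[mu]_(t in I01) F (s * t))%:E) /\
  \int[mul_convolution nu mu]_(t in I01) F t =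
  \int[nu]_(s in I01) (\int[mu]_(t in I01) F (s * t)).
Proof.
move=> nu1 mu1 cF.
pose G := F \_ I01.
have mG : measurable_fun setT (G : measurableTypeR R -> measurableTypeR R).
  exact: (measurable_restrictT _ _).1 (continuous_on01_measurable cF).
have [M M0 HM] := continuous_on01_bounded cF.
have GM t : `|G t| <= M.
  rewrite /G patchE; case: ifPn => [|_]; last by rewrite normr0.
  by rewrite inE /= in_itv /=; exact: HM.
have bounded_integrable d (T : measurableType d) (P : probability T R) (f : T -> R) :
    measurable_fun setT f -> (forall x, `|f x| <= M) -> P.-integrable setT (EFin \o f).
  move=> mf fM; apply: measurable_bounded_integrable => //.
    by apply: le_lt_trans (ltry 1); exact: probability_le1.
  by exists M; split; [exact: num_real|move=> x Mx t _ /=; exact: le_trans (ltW Mx)].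
have iGm : (nu \x mu)%E.-integrable setT (EFin \o (G \o mul_pair)).
  apply: bounded_integrable => [|x]; last exact: GM.
  by apply: measurableT_comp mG measurable_mul_pair.
have iG s : mu.-integrable setT (EFin \o (fun t => G (s * t))).
  apply: bounded_integrable => [|x]; last exact: GM.
  by apply: (measurableT_comp mG); exact: measurable_funM.
have innerE s : 0 <= s <= 1 ->
    (\int[mu]_t (G (s * t))%:E = (\int[mu]_(t in I01) F (s * t))%:E)%E.
  move=> /andP[s0 s1]; rewrite integral01_restrict // /Rintegral fineK; last first.
    apply: integrable_fin_num => //.
    by apply: continuous_on01_integrable; apply: continuous_on01_dilation; rewrite ?s0.
  apply: eq_integral => t; rewrite inE /= in_itv /= => /andP[t0 t1].
  by rewrite /G patchE ifT // inE /= in_itv /= mulr_ge0 //= mulr_ile1.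
have iF := integrable_fubini_F iGm.
have iF01 : nu.-integrable I01 (fun s => (\int[mu]_(t in I01) F (s * t))%:E).
  apply: (@eq_integrable _ _ _ nu I01 _ (fubini_F mu (EFin \o (G \o mul_pair)))) => //.
    by move=> s; rewrite inE /= in_itv /= => s01; rewrite -innerE.
  by apply: integrableS iF.
split => //.
rewrite Rintegral_mkcond -/G /Rintegral integral_pushforward //; last first.
  by apply/measurable_EFinP.
rewrite preimage_setT -integral12_prod_meas1 //.
(* [integral01_restrict] takes a real-valued integrand, whereas the inner integral is extended-real;
   [K] is its finite value. *)
pose K s := fine (\int[mu]_t (G (s * t))%:E)%E.
have KE s : ((K s)%:E = \int[mu]_t (G (s * t))%:E)%E.
  by rewrite fineK //; apply: integrable_fin_num => //; exact: iG.
congr fine.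
transitivity (\int[nu]_s (K s)%:E)%E; first by apply: eq_integral => s _; rewrite KE.
rewrite integral01_restrict //; last first.
  by apply: eq_integrable iF => // s _; rewrite /= KE.
by apply: eq_integral => s; rewrite inE /= in_itv /= => s01; rewrite KE innerE.
Qed.

(** * Moments, polynomial approximation and the kernel inequality *)

Lemma integral01_horner mu (P : {poly R}) :
  \int[mu]_(t in I01) P.[t] = \sum_(i < size P) P`_i * \int[mu]_(t in I01) t ^+ i.
Proof.
under eq_Rintegral do rewrite horner_coef.
elim: (size P) => [|n IHn].
  under eq_Rintegral do rewrite big_ord0.
  by rewrite big_ord0 Rintegral_cst // mul0r.
under eq_Rintegral do rewrite big_ord_recr /=.
have cS : continuous_on01 (fun t : R => \sum_(i < n) P`_i * t ^+ i).
  have -> : (fun t : R => \sum_(i < n) P`_i * t ^+ i) = horner (\poly_(i < n) P`_i).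
    by apply/funext => t; rewrite horner_poly.
  exact: continuous_on01_horner.
have cX := @continuous_on01X n.
have cPn : continuous_on01 (fun t : R => P`_n * t ^+ n).
  by apply: continuous_on01M cX; exact: continuous_on01_cst.
rewrite RintegralD ?IHn ?RintegralZl //; [|exact: continuous_on01_integrable..].
by rewrite big_ord_recr.
Qed.

(** Equal moments give equal integrals of polynomials, and replacing [F] by a polynomial within
    [e / 2] changes each integral by at most [e / 2]. *)
Lemma eq_integral01_moments mu nu F : mu I01 = 1%E -> nu I01 = 1%E ->
  (forall n, \int[mu]_(t in I01) t ^+ n = \int[nu]_(t in I01) t ^+ n) ->
  continuous_on01 F ->
  (forall e : R, 0 < e -> exists P : {poly R}, forall t : R, 0 <= t <= 1 -> `|F t - P.[t]| <= e) ->
  \int[mu]_(t in I01) F t = \int[nu]_(t in I01) F t.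
Proof.
move=> mu1 nu1 mom cF approx; apply/eqP; rewrite -subr_eq0 -normr_le0.
apply/ler_addgt0Pr => e e0; rewrite add0r.
have [|P HP] := approx (e / 2); first by rewrite divr_gt0.
have cP : continuous_on01 (horner P) by exact: continuous_on01_horner.
have dist (m : probability (measurableTypeR R) R) : m I01 = 1%E ->
    `|\int[m]_(t in I01) F t - \int[m]_(t in I01) P.[t]| <= e / 2.
  move=> m1; rewrite -RintegralB //; [|exact: continuous_on01_integrable..].
  by apply: integral01_unit_ball => //; exact: continuous_on01B.
have PE : \int[mu]_(t in I01) P.[t] = \int[nu]_(t in I01) P.[t].
  by rewrite !integral01_horner; apply: eq_bigr => i _; rewrite mom.
have := dist mu mu1; have := dist nu nu1; rewrite PE !ler_norml; lra.
Qed.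

Lemma onePsqr_gt0 (x : R) : 0 < 1 + x ^+ 2.
Proof. by rewrite ltr_pwDl // sqr_ge0. Qed.

Lemma continuous_on01_onePsqrV (y : R) : continuous_on01 (fun t => (1 + (y * t) ^+ 2)^-1).
Proof.
apply: continuous_on01V => [|t _]; last by rewrite gt_eqF ?onePsqr_gt0.
have cyt := continuous_on01M (@continuous_on01_cst y) (@continuous_on01_id).
exact: continuous_on01D (@continuous_on01_cst 1) (continuous_on01M cyt cyt).
Qed.

(* [1 + (y t)^2 = M (1 - q (1 - t^2))] with [M = 1 + y^2] and [q = y^2 / M < 1]: the
   geometric series in [q (1 - t^2)] converges uniformly on [0, 1]. *)
Lemma approx_onePsqrV (a b y e : R) : 0 < e -> exists P : {poly R},
  forall t : R, 0 <= t <= 1 -> `|(a + b * t) / (1 + (y * t) ^+ 2) - P.[t]| <= e.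
Proof.
move=> e0; pose M := 1 + y ^+ 2; pose q := y ^+ 2 / M.
have M0 : 0 < M by exact: onePsqr_gt0.
have q0 : 0 <= q by rewrite divr_ge0 ?sqr_ge0 ?ltW.
have q1 : q < 1 by rewrite ltr_pdivrMr // mul1r /M ltrDr.
have [n qn] : exists n, (`|a| + `|b|) * q ^+ n <= e.
  have /cvgrPdist_le/(_ _ e0) [n _ /(_ n (leqnn n))] :
      geometric (`|a| + `|b|) q @ \oo --> (0 : R).
    by apply: cvg_geometric; rewrite ger0_norm.
  rewrite /= sub0r normrN => H; exists n; apply: le_trans H; exact: ler_norm.
pose Q : {poly R} := q *: (1 - 'X^2).
exists ((a%:P + b *: 'X) * (M^-1 *: \sum_(k < n) Q ^+ k)) => t /andP[t0 t1].
have QE : Q.[t] = q * (1 - t ^+ 2) by rewrite !hornerE.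
have t2 : 0 <= 1 - t ^+ 2 <= 1.
  by rewrite subr_ge0 exprn_ile1 //= lerBlDr lerDl sqr_ge0.
have Q01 : 0 <= Q.[t] <= q by rewrite QE; case/andP: t2 => *; rewrite mulr_ge0 // ler_piMr.
have D0 := onePsqr_gt0 (y * t).
have DE : 1 + (y * t) ^+ 2 = M * (1 - Q.[t]).
  by rewrite QE /q /M; field; rewrite gt_eqF.
have sumE : \sum_(k < n) Q.[t] ^+ k = (1 - Q.[t] ^+ n) / (1 - Q.[t]).
  have Q1 : 1 - Q.[t] != 0 by lra.
  by apply: (mulIf Q1); rewrite divfK // -opprB mulrC mulNr -subrX1 opprB.
have -> : ((a%:P + b *: 'X) * (M^-1 *: \sum_(k < n) Q ^+ k)).[t] =
    (a + b * t) * (M^-1 * \sum_(k < n) Q.[t] ^+ k).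
  rewrite hornerM hornerD hornerZ hornerX hornerC hornerZ horner_sum.
  by under eq_bigr do rewrite horner_exp.
(* This is the exact remainder of the truncated geometric series. On [0, 1] the linear factor is at
   most [|a| + |b|], [Q.[t]] lies in [0, q], and the denominator is at least 1. *)
rewrite [X in `|X|](_ : _ = (a + b * t) * Q.[t] ^+ n / (1 + (y * t) ^+ 2)); last first.
  rewrite DE sumE; move: (Q.[t] ^+ n) (Q.[t]) Q01 => x z z01.
  by field; rewrite gt_eqF //=; lra.
apply: le_trans qn; rewrite !normrM -mulrA ler_pM //.
  apply: le_trans (ler_normD _ _) _; rewrite lerD2l normrM ler_piMr // ger0_norm //.
rewrite normrX normfV (ger0_norm (ltW D0)) (@ger0_norm _ Q.[t]); last by case/andP: Q01.
rewrite ler_pdivrMr // -[X in X <= _]mulr1 ler_pM //.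
- by rewrite exprn_ge0 //; case/andP: Q01.
- by rewrite lerXn2r ?nnegrE //; case/andP: Q01.
- by rewrite lerDl sqr_ge0.
Qed.

(* The integrand of [|f (i y)|^2 (Re (f (s i y) / f (i y)) - 1)] becomes nonnegative after
   symmetrization in the two integration variables. *)
Lemma kernel_symmetrization (s a b : R) : 0 <= s <= 1 -> 0 <= a -> 0 <= b ->
  0 <= ((1 + (s * a) ^+ 2)^-1 - (1 + a ^+ 2)^-1) * (1 + b ^+ 2)^-1
     + (s * a / (1 + (s * a) ^+ 2) - a / (1 + a ^+ 2)) * (b / (1 + b ^+ 2))
     + ((1 + (s * b) ^+ 2)^-1 - (1 + b ^+ 2)^-1) * (1 + a ^+ 2)^-1
     + (s * b / (1 + (s * b) ^+ 2) - b / (1 + b ^+ 2)) * (a / (1 + a ^+ 2)).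
Proof.
move=> /andP[s0 s1] a0 b0.
have [[[Da Db] Dsa] Dsb] := (onePsqr_gt0 a, onePsqr_gt0 b, onePsqr_gt0 (s * a), onePsqr_gt0 (s * b)).
(* Over the common denominator [1 - s] factors out, and the only term of the cofactor that can be
   negative is [- 2ab]. It is absorbed by [(1 + s)(a^2 + b^2) - 2ab = (a - b)^2 + s (a^2 + b^2)]. *)
rewrite [X in 0 <= X](_ : _ = (1 - s) *
   ((1 + s) * (a ^+ 2 + b ^+ 2) - 2 * a * b + s * (1 - s) * (a * b) * (a ^+ 2 + b ^+ 2)
    + 2 * (1 + s) * s ^+ 2 * (a * b) ^+ 2 + 2 * s ^+ 3 * (a * b) ^+ 3) /
   ((1 + a ^+ 2) * (1 + b ^+ 2) * (1 + (s * a) ^+ 2) * (1 + (s * b) ^+ 2))); last first.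
  by field; rewrite !gt_eqF.
rewrite divr_ge0 ?mulr_ge0 ?subr_ge0 ?(ltW Da, ltW Db, ltW Dsa, ltW Dsb) //.
have ab0 : 0 <= a * b by rewrite mulr_ge0.
have s2 : 0 <= a ^+ 2 + b ^+ 2 by rewrite addr_ge0 ?sqr_ge0.
have s1' : 0 <= 1 - s by rewrite subr_ge0.
have sp : 0 <= 1 + s by lra.
do 2! rewrite addr_ge0 ?mulr_ge0 ?exprn_ge0 //.
rewrite addr_ge0 ?mulr_ge0 // [X in 0 <= X](_ : _ = (a - b) ^+ 2 + s * (a ^+ 2 + b ^+ 2)); last by ring.
by rewrite addr_ge0 ?sqr_ge0 ?mulr_ge0.
Qed.
End UnitInterval.

(** * The inequality for a single dilation factor [s] *)

Section Dilation.
Set Implicit Arguments.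
Unset Strict Implicit.
Variable R : realType.
Implicit Types (mu nu : probability (measurableTypeR R) R) (F G : R -> R).
Local Notation I01 := (`[0, 1]%classic : set R).

Lemma integral01_lin2 mu F G (a b : R) : continuous_on01 F -> continuous_on01 G ->
  \int[mu]_(t in I01) (a * F t + b * G t) =
  a * (\int[mu]_(t in I01) F t) + b * (\int[mu]_(t in I01) G t).
Proof.
move=> cF cG.
have caF := continuous_on01M (@continuous_on01_cst _ a) cF.
have cbG := continuous_on01M (@continuous_on01_cst _ b) cG.
by rewrite RintegralD ?RintegralZl //; exact: continuous_on01_integrable.
Qed.

Lemma continuous_on01_lin2 F G (a b : R) : continuous_on01 F -> continuous_on01 G ->
  continuous_on01 (fun t => a * F t + b * G t).
Proof.
move=> cF cG; apply: continuous_on01D.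
  exact: continuous_on01M (@continuous_on01_cst _ a) cF.
exact: continuous_on01M (@continuous_on01_cst _ b) cG.
Qed.

(** With [f] the transform of [mu], [u + iv] is [f(iy)] and the right-hand side is the real part of
    [f(siy)] times the conjugate of [f(iy)]. The symmetrized kernel is integrated first in [t], then
    in [r]; each time the integrand is a combination of [phi], [psi] and their dilates, which [lin4]
    evaluates. *)
Lemma dilation_integral_ge mu (s y u v : R) : mu I01 = 1%E -> 0 <= s <= 1 -> 0 <= y ->
  u = \int[mu]_(t in I01) (1 + (y * t) ^+ 2)^-1 ->
  v = \int[mu]_(t in I01) (y * t / (1 + (y * t) ^+ 2)) ->
  u ^+ 2 + v ^+ 2 <=
    \int[mu]_(t in I01) ((u + v * y * (s * t)) / (1 + (y * (s * t)) ^+ 2)).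
Proof.
move=> mu1 s01 y0 uE vE.
pose phi t : R := (1 + (y * t) ^+ 2)^-1.
pose psi t : R := y * t / (1 + (y * t) ^+ 2).
have cphi : continuous_on01 phi by exact: continuous_on01_onePsqrV.
have cpsi : continuous_on01 psi.
  apply: continuous_on01M cphi.
  exact: continuous_on01M (@continuous_on01_cst _ y) (@continuous_on01_id _).
have cphis := continuous_on01_dilation s01 cphi.
have cpsis := continuous_on01_dilation s01 cpsi.
pose A := \int[mu]_(t in I01) phi (s * t).
pose B := \int[mu]_(t in I01) psi (s * t).
have lin4 (a b c d : R) : \int[mu]_(t in I01) ((a * phi (s * t) + b * psi (s * t))
    + (c * phi t + d * psi t)) = (a * A + b * B) + (c * u + d * v).
  rewrite RintegralD //; try exact/continuous_on01_integrable/continuous_on01_lin2.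
  by rewrite !integral01_lin2 // uE vE.
have clin4 (a b c d : R) : continuous_on01 (fun t =>
    (a * phi (s * t) + b * psi (s * t)) + (c * phi t + d * psi t)).
  by apply: continuous_on01D; exact: continuous_on01_lin2.
rewrite [X in _ <= X](_ : _ = u * A + v * B); last first.
  rewrite -integral01_lin2 //; apply: eq_Rintegral => t _.
  by rewrite /phi /psi; move: (_ ^-1) => x; ring.
(* This is the symmetrized kernel at [a = y t], [b = y r], integrated in [t]. The terms not
   involving [s] occur in both halves of the symmetrization, hence the coefficients 2. Integrating
   in [r] then gives twice [u A + v B - u^2 - v^2]. *)
have ptwise (r : R) : 0 <= r <= 1 -> 0 <=
    (u * phi (s * r) + v * psi (s * r)) + ((A - 2 * u) * phi r + (B - 2 * v) * psi r).
  move=> /andP[r0 r1].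
  rewrite [X in 0 <= X](_ : _ = \int[mu]_(t in I01) (
      (phi r * phi (s * t) + psi r * psi (s * t))
      + ((phi (s * r) - 2 * phi r) * phi t + (psi (s * r) - 2 * psi r) * psi t))).
    apply: integral01_ge => //; first exact/continuous_on01_integrable.
    move=> t /andP[t0 t1].
    have := @kernel_symmetrization R s (y * t) (y * r) s01 (mulr_ge0 y0 t0) (mulr_ge0 y0 r0).
    congr (0 <= _); rewrite /phi /psi !(mulrCA s y).
    by move: (_^-1) (_^-1) (_^-1) (_^-1) => *; ring.
  by rewrite lin4; ring.
have := integral01_ge mu1 (continuous_on01_integrable mu (clin4 _ _ _ _)) ptwise.
rewrite lin4; nra.
Qed.
End Dilation.


(** * Complex-valued integrands on [0, 1] *)

Section Stieltjes.
Set Implicit Arguments.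
Unset Strict Implicit.
Variable R : realType.
Implicit Types (mu nu : probability (measurableTypeR R) R) (F G : R -> R[i]).
Local Notation I01 := (`[0, 1]%classic : set R).

Definition ccontinuous_on01 F :=
  continuous_on01 (fun t => complex.Re (F t)) /\
  continuous_on01 (fun t => complex.Im (F t)).

Lemma Re_mulc (z w : R[i]) :
  complex.Re (z * w) = complex.Re z * complex.Re w - complex.Im z * complex.Im w.
Proof. by case: z; case: w. Qed.

Lemma Im_mulc (z w : R[i]) :
  complex.Im (z * w) = complex.Re z * complex.Im w + complex.Im z * complex.Re w.
Proof. by case: z; case: w. Qed.

Lemma ccontinuous_on01_cst (c : R[i]) : ccontinuous_on01 (fun=> c).
Proof. by split; apply: continuous_on01_cst. Qed.

Lemma ccontinuous_on01_real (f : R -> R) : continuous_on01 f ->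
  ccontinuous_on01 (fun t => (f t)%:C).
Proof. by move=> cf; split => //; apply: continuous_on01_cst. Qed.

Lemma ccontinuous_on01M F G : ccontinuous_on01 F -> ccontinuous_on01 G ->
  ccontinuous_on01 (fun t => F t * G t).
Proof.
move=> [rF iF] [rG iG]; split.
  under eq_fun do rewrite Re_mulc.
  by apply: continuous_on01B; exact: continuous_on01M.
under eq_fun do rewrite Im_mulc.
by apply: continuous_on01D; exact: continuous_on01M.
Qed.

Lemma ccontinuous_on01X F n : ccontinuous_on01 F -> ccontinuous_on01 (fun t => F t ^+ n).
Proof.
move=> cF; elim: n => [|n IHn]; first exact: ccontinuous_on01_cst.
by under eq_fun do rewrite exprS; exact: ccontinuous_on01M.
Qed.

(** Otherwise [t] is nonzero and [z = 1 / t] lies on the cut. *)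
Lemma cut_plane_neq0 (z : R[i]) (t : R) : cut_plane z -> 0 <= t <= 1 -> 1 - t%:C * z != 0.
Proof.
move=> cz /andP[t0 t1]; apply/eqP => /eqP; rewrite subr_eq0 => /eqP tz; apply: cz.
have t0' : t != 0.
  by apply/eqP => tz0; move: tz; rewrite tz0 mul0r => /eqP; rewrite oner_eq0.
exists t^-1.
  by rewrite /= in_itv /= andbT invf_ge1 // lt_def t0'.
have tC0 : t%:C != 0 :> R[i] by rewrite eq_complex /= eqxx andbT; exact: t0'.
by apply: (mulfI tC0); rewrite -tz -rmorphM divff.
Qed.

Lemma Re_invc (z : R[i]) :
  complex.Re z^-1 = complex.Re z / (complex.Re z ^+ 2 + complex.Im z ^+ 2).
Proof. by case: z. Qed.

Lemma Im_invc (z : R[i]) :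
  complex.Im z^-1 = - (complex.Im z / (complex.Re z ^+ 2 + complex.Im z ^+ 2)).
Proof. by case: z. Qed.

Lemma ccontinuous_on01V F : ccontinuous_on01 F ->
  (forall t : R, 0 <= t <= 1 -> F t != 0) -> ccontinuous_on01 (fun t => (F t)^-1).
Proof.
move=> [rF iF] F0.
have cN : continuous_on01 (fun t => (complex.Re (F t) ^+ 2 + complex.Im (F t) ^+ 2)^-1).
  apply: continuous_on01V => [|t t01].
    by apply: continuous_on01D; exact: continuous_on01M.
  apply: contraNneq (F0 t t01) => /eqP.
  by rewrite paddr_eq0 ?sqr_ge0 // !sqrf_eq0 eq_complex.
split; first by under eq_fun do rewrite Re_invc; exact: continuous_on01M.
under eq_fun do rewrite Im_invc -mulrN1.
by apply: continuous_on01M; [exact: continuous_on01M|exact: continuous_on01_cst].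
Qed.

Lemma ccontinuous_on01_affine (z : R[i]) : ccontinuous_on01 (fun t => 1 - t%:C * z).
Proof.
split; rewrite /=.
  under eq_fun do rewrite raddfB /= Re_mulc /= mul0r subr0.
  apply: continuous_on01B; first exact: continuous_on01_cst.
  by apply: continuous_on01M; [exact: continuous_on01_id|exact: continuous_on01_cst].
under eq_fun do rewrite raddfB /= Im_mulc /= mul0r addr0.
apply: continuous_on01B; first exact: continuous_on01_cst.
by apply: continuous_on01M; [exact: continuous_on01_id|exact: continuous_on01_cst].
Qed.

Lemma eq_cintegral mu F G : (forall t : R, 0 <= t <= 1 -> F t = G t) ->
  cintegral mu I01 F = cintegral mu I01 G.
Proof.
move=> FG; rewrite /cintegral; congr (_ +i* _); apply: eq_Rintegral => t;
  by rewrite inE /= in_itv /= => /FG ->.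
Qed.

Lemma cintegralB mu F G : ccontinuous_on01 F -> ccontinuous_on01 G ->
  cintegral mu I01 (fun t => F t - G t) = cintegral mu I01 F - cintegral mu I01 G.
Proof.
move=> [rF iF] [rG iG]; rewrite {2 3}/cintegral; simpc; rewrite /cintegral.
congr (_ +i* _); under eq_Rintegral do rewrite raddfB /=;
  by rewrite RintegralB //; exact: continuous_on01_integrable.
Qed.

Lemma cintegralMr mu F (c : R[i]) : ccontinuous_on01 F ->
  cintegral mu I01 (fun t => F t * c) = cintegral mu I01 F * c.
Proof.
move=> [rF iF]; apply/eqP; rewrite eq_complex Re_mulc Im_mulc /=; apply/andP; split; apply/eqP.
  under eq_Rintegral do rewrite Re_mulc mulrC [X in _ - X]mulrC -mulNr.
  by rewrite integral01_lin2 // mulNr mulrC [X in _ - X]mulrC.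
under eq_Rintegral do rewrite Im_mulc mulrC [X in _ + X]mulrC.
by rewrite integral01_lin2 // mulrC [X in _ + X]mulrC.
Qed.

Lemma cintegral_real mu (f : R -> R) :
  cintegral mu I01 (fun t => (f t)%:C) = (\int[mu]_(t in I01) f t)%:C.
Proof. by rewrite /cintegral /= Rintegral_cst // mul0r. Qed.

Lemma normci : `|'i%C : R[i]| = 1.
Proof. by rewrite complexiE normCi. Qed.

Lemma normc_real (x : R) : `|x%:C| = `|x|%:C.
Proof. by rewrite normc_def /= expr0n addr0 sqrtr_sqr. Qed.

Lemma norm_ReIm (z : R[i]) (c : R) : `|z| <= c%:C ->
  `|complex.Re z| <= c /\ `|complex.Im z| <= c.
Proof.
move=> zc; split; rewrite -lecR.
  exact: le_trans (normc_ge_Re z) zc.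
rewrite -normrN -ReiNIm; apply: le_trans (normc_ge_Re _) _.
by rewrite normrM normci mulr1.
Qed.

(** The real and imaginary parts are bounded separately, which costs a factor 2, harmless for a
    remainder that tends to 0. *)
Lemma cintegral_bound mu F (c : R) : mu I01 = 1%E -> ccontinuous_on01 F ->
  (forall t : R, 0 <= t <= 1 -> `|F t| <= c%:C) ->
  `|cintegral mu I01 F| <= (c + c)%:C.
Proof.
move=> mu1 [rF iF] Fc; rewrite [cintegral _ _ _]complexE rmorphD.
apply: le_trans (ler_normD _ _) _; rewrite normrM normci mul1r.
apply: lerD; rewrite normc_real lecR; apply: integral01_unit_ball => // t /Fc /norm_ReIm [] //.
Qed.

(** * Moments as Taylor coefficients, and the Hadamard product *)

Definition moment mu n : R := \int[mu]_(t in I01) t ^+ n.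

Lemma ccontinuous_on01_remainder (z : R[i]) n : cut_plane z ->
  ccontinuous_on01 (fun t : R => (t%:C * z) ^+ n * (1 - t%:C * z)^-1).
Proof.
move=> cz; apply: ccontinuous_on01M.
  apply: ccontinuous_on01X; apply: ccontinuous_on01M; last exact: ccontinuous_on01_cst.
  exact: ccontinuous_on01_real (@continuous_on01_id _).
by apply: ccontinuous_on01V (ccontinuous_on01_affine z) _ => t; exact: cut_plane_neq0.
Qed.

(** The finite geometric identity in [w = t z], integrated in [t]; the induction step is
    [w^n / (1 - w) - w^n = w^(n+1) / (1 - w)]. *)
Lemma cintegral_remainder mu (z : R[i]) n : cut_plane z ->
  cintegral mu I01 (fun t => (1 - t%:C * z)^-1) - \sum_(k < n) (moment mu k)%:C * z ^+ k =
  cintegral mu I01 (fun t => (t%:C * z) ^+ n * (1 - t%:C * z)^-1).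
Proof.
move=> cz; elim: n => [|n IHn].
  by rewrite big_ord0 subr0; apply: eq_cintegral => t _; rewrite mul1r.
have cX := @continuous_on01X R n.
have cXC := ccontinuous_on01_real cX.
rewrite big_ord_recr /= opprD addrA IHn /moment -cintegral_real -cintegralMr // -cintegralB.
- apply: eq_cintegral => t t01; have d0 := cut_plane_neq0 cz t01.
  by rewrite rmorphXn /= exprS !exprMn; move: d0 (z ^+ n) (t%:C ^+ n) => d0 p q; field.
- exact: ccontinuous_on01_remainder.
- by apply: ccontinuous_on01M => //; exact: ccontinuous_on01_cst.
Qed.

Lemma cut_plane_disk (z : R[i]) : `|z| < 1 -> cut_plane z.
Proof.
move=> z1 [x]; rewrite /= in_itv /= andbT => x1 xz; move: z1.
rewrite -xz normc_real ltcR ger0_norm ?(le_trans ler01) //.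
by rewrite ltNge x1.
Qed.

Lemma has_taylor_moment mu (f : R[i] -> R[i]) : mu I01 = 1%E ->
  (forall z, cut_plane z -> f z = cintegral mu I01 (fun t => (1 - t%:C * z)^-1)) ->
  has_taylor f (fun k => (moment mu k)%:C).
Proof.
move=> mu1 fE z z1; have cz := cut_plane_disk z1.
(* The modulus takes values in [R[i]]; its real part [r] is the usable ratio. Since
   [|1 - t z| >= 1 - r], the remainder is at most [2 r^n / (1 - r)]. *)
have zr : `|z| = (complex.Re `|z|)%:C by rewrite normc_def.
move: z1; rewrite zr; set r := complex.Re _ => z1.
have r1 : r < 1 by rewrite -ltcR.
have r0 : 0 <= r by rewrite -ler0c -zr.
have bnd n : `|f z - series (fun k => (moment mu k)%:C * z ^+ k) n| <=
    (r ^+ n / (1 - r) + r ^+ n / (1 - r))%:C.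
  rewrite fE // /series /= big_mkord cintegral_remainder //.
  apply: cintegral_bound => //; first exact: ccontinuous_on01_remainder.
  move=> t /andP[t0 t1].
  have tz : `|t%:C * z| <= r%:C.
    rewrite normrM normc_real (ger0_norm t0) zr -/r -rmorphM lecR /= ler_piMl //.
  rewrite normrM normrX normfV rmorphM rmorphXn fmorphV /=; apply: ler_pM => //.
    by apply: lerXn2r => //; rewrite nnegrE ?normr_ge0 ?ler0c.
  have d0 : 0 < (1 - r)%:C :> R[i] by rewrite ltcR subr_gt0.
  have dle : (1 - r)%:C <= `|1 - t%:C * z|.
    apply: le_trans (lerB_dist _ _); rewrite normr1 rmorphB /= lerD2l lerN2.
    exact: tz.
  by rewrite lef_pV2 // ?posrE // (lt_le_trans d0).
apply/cvgrPdist_le => eps eps0.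
have epsE : eps = (complex.Re eps)%:C by rewrite RRe_real // gtr0_real.
have e0 : 0 < complex.Re eps by rewrite -ltcR -epsE.
have /cvgrPdist_le/(_ _ e0) : geometric (2 / (1 - r)) r @ \oo --> (0 : R).
  by apply: cvg_geometric; rewrite ger0_norm.
apply: filterS => n /=; rewrite sub0r normrN => H.
apply: le_trans (bnd n) _; rewrite epsE lecR; apply: le_trans (ler_norm _) _.
apply: le_trans H; rewrite le_eqVlt; apply/orP; left; apply/eqP; congr `|_|.
by move: (_^-1) (r ^+ n) => p q; ring.
Qed.

Lemma has_taylor_unique (f : R[i] -> R[i]) (a b : nat -> R[i]) :
  has_taylor f a -> has_taylor f b -> a =1 b.
Proof.
move=> fa fb k; apply/eqP; rewrite -subr_eq0; apply/eqP; move: k.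
apply: (@pseries_eq0 _ (fun k => a k - b k)) => x x0 x1.
have nx : `|x| < 1 by rewrite gtr0_norm.
rewrite -[X in _ --> X](subrr (f x)).
have -> : series (fun k => (a k - b k) * x ^+ k : R[i]^o) =
    series (fun k => a k * x ^+ k : R[i]^o) \- series (fun k => b k * x ^+ k : R[i]^o).
  apply/funext => n; rewrite /series /= -sumrB.
  by apply: eq_bigr => i _; rewrite mulrBl.
by apply: cvgB; [exact: fa|exact: fb].
Qed.

Lemma moment_mul_convolution nu mu n : nu I01 = 1%E -> mu I01 = 1%E ->
  moment (mul_convolution nu mu) n = moment nu n * moment mu n.
Proof.
move=> nu1 mu1; have cX := @continuous_on01X R n.
rewrite /moment (integral_mul_convolution nu1 mu1 cX).2.
rewrite -RintegralZr //; last exact: continuous_on01_integrable.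
apply: eq_Rintegral => s _; rewrite -RintegralZl //; last exact: continuous_on01_integrable.
by apply: eq_Rintegral => t _; rewrite exprMn.
Qed.

(** The transform of the convolution is a witness, so [xget] does not return its default value 0.
    The function it selects is known only through [is_hadamard]. *)
Lemma hadamardP (f g : R[i] -> R[i]) : classT f -> classT g ->
  is_hadamard f g (hadamard f g).
Proof.
move=> [mu mu1 fE] [nu nu1 gE].
apply: (@xgetPex _ _ [set h | is_hadamard f g h]).
have k1 := mul_convolution_unit mu1 nu1.
exists (fun z => cintegral (mul_convolution mu nu) I01 (fun t => (1 - t%:C * z)^-1)).
split; first by exists (mul_convolution mu nu).
exists (fun k => (moment mu k)%:C), (fun k => (moment nu k)%:C).
split; [exact: has_taylor_moment|exact: has_taylor_moment|].
rewrite (_ : (fun k => _) = (fun k => (moment (mul_convolution mu nu) k)%:C)).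
  exact: has_taylor_moment.
by apply/funext => k; rewrite moment_mul_convolution // rmorphM.
Qed.

(** * Values on the imaginary axis and the conclusion *)

Lemma cut_plane_imaginary (y : R) : 0 < y -> cut_plane ('i%C * y%:C).
Proof.
move=> y0 [x _] /(congr1 (@complex.Im R)) /=; rewrite mul0r mul1r add0r => y0'.
by move: y0; rewrite -y0' ltxx.
Qed.

Lemma cintegral_imaginary mu (y : R) :
  cintegral mu I01 (fun t => (1 - t%:C * ('i%C * y%:C))^-1) =
  (\int[mu]_(t in I01) (1 + (y * t) ^+ 2)^-1) +i*
  (\int[mu]_(t in I01) (y * t / (1 + (y * t) ^+ 2))).
Proof.
rewrite /cintegral; congr (_ +i* _); apply: eq_Rintegral => t _; rewrite ?Re_invc ?Im_invc; simpc => /=;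
  by rewrite expr1n sqrrN (mulrC t) ?div1r ?mulNr ?opprK.
Qed.

(** The real part of the quotient is [(A u + B v) / (u^2 + v^2)], with positive denominator since
    [u > 0]. *)
Lemma Re_div_ge1 (A B u v : R) : 0 < u -> u ^+ 2 + v ^+ 2 <= A * u + B * v ->
  1 <= complex.Re ((A +i* B) / (u +i* v)).
Proof.
move=> u0 H; have D0 : 0 < u ^+ 2 + v ^+ 2 by rewrite ltr_wpDr ?sqr_ge0 ?exprn_gt0.
rewrite Re_mulc Re_invc Im_invc /= mulrN opprK !mulrA -mulrDl.
by rewrite ler_pdivlMr // mul1r.
Qed.
End Stieltjes.

Theorem theorem1p3 (R : realType) (f g : R[i] -> R[i])
  (hf : classT f) (hg : classT g) (y : R) (hy : 0 < y) :
  1 <= complex.Re (hadamard f g ('i%C * y%:C) / f ('i%C * y%:C)).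
Proof.
have [[la la1 hE] [a [b [fa gb hab]]]] := hadamardP hf hg.
have [mu mu1 fE] := hf; have [nu nu1 gE] := hg.
(* Uniqueness of Taylor coefficients turns [a] and [b] into the moments of [mu] and [nu]. The order
   [nu], [mu] puts the measure of [f] in the inner integral, as the dilation inequality requires. *)
have momE n : moment la n = moment (mul_convolution nu mu) n.
  apply: complexI.
  rewrite (has_taylor_unique (has_taylor_moment la1 hE) hab n) moment_mul_convolution //.
  rewrite (has_taylor_unique fa (has_taylor_moment mu1 fE) n).
  by rewrite (has_taylor_unique gb (has_taylor_moment nu1 gE) n) mulrC -rmorphM.
have ciy := cut_plane_imaginary hy.
rewrite hE // fE // !cintegral_imaginary.
set u := \int[mu]_(t in _) _; set v := \int[mu]_(t in _) _.
have cphi : continuous_on01 (fun t : R => (1 + (y * t) ^+ 2)^-1).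
  exact: continuous_on01_onePsqrV.
have cyt : continuous_on01 (fun t => y * t).
  exact: continuous_on01M (@continuous_on01_cst _ y) (@continuous_on01_id _).
have cpsi := continuous_on01M cyt cphi.
apply: Re_div_ge1.
  (* On [0, 1] the integrand of [u] is smallest at [t = 1]. *)
  apply: (@lt_le_trans _ _ (1 + y ^+ 2)^-1); first by rewrite invr_gt0 onePsqr_gt0.
  apply: integral01_ge => //; first exact: continuous_on01_integrable.
  move=> t /andP[t0 t1]; rewrite lef_pV2 ?posrE ?onePsqr_gt0 //.
  by rewrite lerD2l exprMn ler_piMr ?sqr_ge0 // exprn_ile1.
(* With [u] and [v] frozen as constants, [A u + B v] becomes one integral of [H] against [la]. By
   moments it can be moved to the convolution, then written as a [nu]-average over [s] of the
   integrals bounded below by [dilation_integral_ge]. *)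
pose H t := (u + v * y * t) / (1 + (y * t) ^+ 2).
have cH : continuous_on01 H.
  apply: continuous_on01M cphi; apply: continuous_on01D; first exact: continuous_on01_cst.
  exact: continuous_on01M (@continuous_on01_cst _ _) (@continuous_on01_id _).
rewrite [X in _ <= X](_ : _ = \int[la]_(t in `[0, 1]) H t); last first.
  rewrite mulrC [X in _ + X]mulrC -integral01_lin2 //.
  by apply: eq_Rintegral => t _; rewrite /H; move: (_^-1) => p; ring.
have k1 := mul_convolution_unit nu1 mu1.
rewrite (eq_integral01_moments la1 k1 momE cH); last first.
  by move=> e e0; exact: approx_onePsqrV.
have [iH ->] := integral_mul_convolution nu1 mu1 cH.
apply: integral01_ge => // s s01.
by apply: dilation_integral_ge => //; exact: ltW.
Qed.
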